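(* Let $X$ be a smooth projective split toric variety over $\mathbb{Q}$ with $-K_X$ globally generated, of dimension $d$, with $r=\operatorname{rank}\operatorname{Pic}(X)$. For every fixed $A>0$, as $B\to\infty$, $$\#\big(\mathcal{A}(B)\setminus\mathcal{A}^{(A)\flat}(B)\big)=O_A\big(B(\log B)^{r-2}\log\log B\big).$$
   Context: $X$ is defined by a complete regular fan $\Delta$ in $N_\mathbb{R}$, $N\cong\mathbb{Z}^d$, $M=\operatorname{Hom}(N,\mathbb{Z})$; $\Delta(1)$ is the set of rays, $n=\#\Delta(1)=r+d$, $n_\rho$ the primitive generator of $\rho$, $\Delta_{\max}$ the set of maximal cones, $\sigma(1)$ the rays of $\sigma$. For $\sigma\in\Delta_{\max}$, $\{n_\rho:\rho\in\sigma(1)\}$ is a basis of $N$; let $m_\sigma\in M$ be the unique element with $\langle m_\sigma,n_\rho\rangle=1$ for all $\rho\in\sigma(1)$, and $a_\rho(\sigma)=1-\langle m_\sigma,n_\rho\rangle$ (which is $\ge0$). For $\mathbf{X}=(X_\rho)_{\rho\in\Delta(1)}$ with positive entries, $\mathbf{X}^{D_0(\sigma)}=\prod_\rho X_\rho^{a_\rho(\sigma)}$. Let $\mathcal{A}(B)=\{\mathbf{X}\in\mathbb{Z}_{\ge1}^{\Delta(1)}:\max_{\sigma\in\Delta_{\max}}\mathbf{X}^{D_0(\sigma)}\le B\}$. For $\sigma\in\Delta_{\max}$ and $\rho'\in\sigma(1)$, let $n^\vee_{\sigma,\rho'}\in M$ be the element of the dual basis with $\langle n^\vee_{\sigma,\rho'},n_\rho\rangle=\delta_{\rho\rho'}$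 for $\rho\in\sigma(1)$, and $\mathbf{X}^{E_\sigma(\rho')}=\prod_{\rho\notin\sigma(1)}X_\rho^{-\langle n^\vee_{\sigma,\rho'},n_\rho\rangle}$. Then $\mathcal{A}^{(A)\flat}(B)=\{\mathbf{X}\in\mathcal{A}(B):\mathbf{X}^{E_\sigma(\rho')}\ge(\log B)^A\text{ for all }\sigma\in\Delta_{\max},\rho'\in\sigma(1)\}$. *)

(* Defs.v *)
From HB Require Import structures.
From Stdlib Require Import ClassicalEpsilon.
From mathcomp Require Import all_boot all_order all_algebra.
From mathcomp Require Import all_classical all_reals all_analysis.
Set Implicit Arguments. Unset Strict Implicit. Unset Printing Implicit Defensive.
Import Order.TTheory GRing.Theory Num.Theory.
Local Open Scope ring_scope.

(* A toric fan in N_R = R^d, N = Z^d, with n rays.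
   v rho : 'I_d -> int is the primitive generator n_rho; maximal cones are
   given by their sets of rays S : {set {set 'I_n}}. M = Hom(N,Z) = Z^d with
   the standard pairing. *)

Definition pair (d : nat) (m x : 'I_d -> int) : int := \sum_(i < d) m i * x i.

Definition in_cone (R : realType) (d n : nat) (v : 'I_n -> 'I_d -> int)
  (sigma : {set 'I_n}) (x : 'I_d -> R) : Prop :=
  exists c : 'I_n -> R, (forall rho, 0 <= c rho) /\
    (forall rho, rho \notin sigma -> c rho = 0) /\
    (forall i, x i = \sum_(rho < n) c rho * (v rho i)%:~R).

Definition is_Zbasis (d n : nat) (v : 'I_n -> 'I_d -> int) (sigma : {set 'I_n}) : Prop :=
  (forall x : 'I_d -> int, exists c : 'I_n -> int,
      forall i, x i = \sum_(rho in sigma) c rho * v rho i) /\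
  (forall c : 'I_n -> int,
      (forall i, \sum_(rho in sigma) c rho * v rho i = 0) ->
      forall rho, rho \in sigma -> c rho = 0).

(* complete regular fan whose maximal cones are S and whose set of rays is
   {v rho}, which is projective (admits a strictly convex integral support
   function, i.e. an ample divisor). *)
Definition smooth_projective_fan (R : realType) (d n : nat)
  (v : 'I_n -> 'I_d -> int) (S : {set {set 'I_n}}) : Prop :=
  injective v /\
      (forall rho, exists2 sigma, sigma \in S & rho \in sigma) /\
      (forall sigma, sigma \in S -> #|sigma| = d /\ is_Zbasis v sigma) /\
      (forall sigma tau, sigma \in S -> tau \in S -> forall x : 'I_d -> R,
          in_cone v sigma x -> in_cone v tau x -> in_cone v (sigma :&: tau) x) /\
      (forall x : 'I_d -> R, exists2 sigma, sigma \in S & in_cone v sigma x) /\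
      (exists h : 'I_n -> int, forall sigma, sigma \in S ->
          exists m : 'I_d -> int,
            (forall rho, rho \in sigma -> pair m (v rho) = h rho) /\
            (forall rho, rho \notin sigma -> h rho < pair m (v rho))).

Definition m_sigma (d n : nat) (v : 'I_n -> 'I_d -> int) (sigma : {set 'I_n})
  : 'I_d -> int :=
  epsilon (inhabits (fun _ => 0))
    (fun m => forall rho, rho \in sigma -> pair m (v rho) = 1).

Definition a_coef (d n : nat) (v : 'I_n -> 'I_d -> int) (sigma : {set 'I_n})
  (rho : 'I_n) : int := 1 - pair (m_sigma v sigma) (v rho).

Definition antican_gg (d n : nat) (v : 'I_n -> 'I_d -> int) (S : {set {set 'I_n}})
  : Prop := forall sigma, sigma \in S -> forall rho, 0 <= a_coef v sigma rho.

Definition XD0 (R : realType) (d n : nat) (v : 'I_n -> 'I_d -> int)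
  (sigma : {set 'I_n}) (X : {ffun 'I_n -> nat}) : R :=
  \prod_(rho < n) ((X rho)%:R) ^ (a_coef v sigma rho).

Definition ndual (d n : nat) (v : 'I_n -> 'I_d -> int) (sigma : {set 'I_n})
  (rho' : 'I_n) : 'I_d -> int :=
  epsilon (inhabits (fun _ => 0))
    (fun m => forall rho, rho \in sigma -> pair m (v rho) = (rho == rho')%:Z).

Definition XE (R : realType) (d n : nat) (v : 'I_n -> 'I_d -> int)
  (sigma : {set 'I_n}) (rho' : 'I_n) (X : {ffun 'I_n -> nat}) : R :=
  \prod_(rho < n | rho \notin sigma)
     ((X rho)%:R) ^ (- pair (ndual v sigma rho') (v rho)).

Definition inA (R : realType) (d n : nat) (v : 'I_n -> 'I_d -> int)
  (S : {set {set 'I_n}}) (B : R) (X : {ffun 'I_n -> nat}) : Prop :=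
  (forall rho, (1 <= X rho)%N) /\
  (forall sigma, sigma \in S -> XD0 R v sigma X <= B).

Definition inAflat (R : realType) (d n : nat) (v : 'I_n -> 'I_d -> int)
  (S : {set {set 'I_n}}) (A B : R) (X : {ffun 'I_n -> nat}) : Prop :=
  inA v S B X /\
  (forall sigma, sigma \in S -> forall rho', rho' \in sigma ->
      (ln B) `^ A <= XE R v sigma rho' X).

(* Main.v *)
Require Import Defs.
From HB Require Import structures.
From Stdlib Require Import ClassicalEpsilon.
From mathcomp Require Import all_boot all_order all_algebra.
From mathcomp Require Import zify ring lra.
From mathcomp Require Import all_classical all_reals all_analysis.
Import Order.TTheory GRing.Theory Num.Theory.
Local Open Scope ring_scope.

(** Idea.  Put X in its dyadic box, k_rho = floor (log_2 X_rho), and write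
    - sum_rho k_rho n_rho = sum_rho t_rho n_rho with natural t supported on a
    maximal cone tau.  Then D := |k| + |t| is the exponent D_0(tau) evaluated
    at k, so 2^D <= B, and the box contains 2^(D - |t|) points X.  If X is not
    flat, some X^{E_sigma(rho')} is small; since E_sigma(rho') at k equals
    k_rho' + O(|t|), this forces k_rho' <= W := O(log log B + |t|).

    For fixed (D, t), k is subject to d + 1 independent linear equations: its
    degree |k| and sum_rho k_rho n_rho are known.  Either the coordinate
    k_rho' is independent of these d + 1 forms, which leaves
    O(W (log B)^(n-d-2)) values of k; or it is a combination of them, in which
    the coefficient of |k| cannot vanish since the fan is complete, so that
    D = O(1 + W + |t|).  Both cases give at most
    O((1 + W + |t|) (log B)^(n-d-1) / (D + 1)) values of k, and
    sum_{D <= L} 2^D / (D + 1) = O(2^L / (L + 1)) supplies the missing power of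
    log B, while the factor 2^(-|t|) makes the sum over t converge. *)

(** * Lattice points of a box on an affine subspace *)

Definition natcol {n L : nat} (k : {ffun 'I_n -> 'I_L.+1}) : 'cV[rat]_n :=
  \col_i (k i)%:R.

Lemma card_slices {n L : nat} (P : pred {ffun 'I_n -> 'I_L.+1}) (j : 'I_n)
    (W c : nat) :
  (forall w : nat, (#|[set k | P k && (k j == w :> nat)]| <= c)%N) ->
  (#|[set k | P k && (k j <= W)%N]| <= W.+1 * c)%N.
Proof.
move=> hc; rewrite -sum1_card.
rewrite (partition_big (fun k : {ffun 'I_n -> 'I_L.+1} => inord (k j) : 'I_W.+1) xpredT) //=.
rewrite -[X in (_ <= X * _)%N]card_ord -sum_nat_const.
apply: leq_sum => w _; apply: leq_trans (hc w); rewrite -sum1_card.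
rewrite [leqLHS]big_mkcond [leqRHS]big_mkcond /=; apply: leq_sum => k _.
rewrite !inE; case: ifP => // /andP[/andP[-> kW] /eqP <-].
by rewrite inordK // eqxx.
Qed.

Lemma mxrank_col_delta {F : fieldType} {n q : nat} (M : 'M[F]_(q, n)) (j : 'I_n) :
  ~~ ((delta_mx 0 j : 'rV[F]_n) <= M)%MS ->
  \rank (col_mx M (delta_mx 0 j : 'rV[F]_n)) = (\rank M).+1.
Proof.
move=> hj; rewrite -addsmxE.
have h0 : (M :&: (delta_mx 0 j : 'rV[F]_n) = 0)%MS.
  apply/eqP; rewrite -mxrank_eq0; apply: contraR hj; rewrite -lt0n => h.
  apply: submx_trans (capmxSl M (delta_mx 0 j : 'rV[F]_n)).
  rewrite -(geq_leqif (mxrank_leqif_sup (capmxSr _ _))).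
  by rewrite mxrank_delta.
by rewrite (mxrank_disjoint_sum h0) mxrank_delta addn1.
Qed.

Lemma col_delta_eq {n L q : nat} (M : 'M[rat]_(q, n)) (j : 'I_n) b (w : nat)
    (k : {ffun 'I_n -> 'I_L.+1}) :
  (col_mx M (delta_mx 0 j : 'rV[rat]_n) *m natcol k == col_mx b (w%:R)%:M) =
  (M *m natcol k == b) && (k j == w :> nat).
Proof.
rewrite mul_col_mx -rowE; apply/eqP/andP => [/eq_col_mx[-> e]|[/eqP-> /eqP e]].
  split=> //; move/matrixP: e => /(_ 0 0); rewrite !mxE eqxx /= => /eqP.
  by rewrite eqr_nat.
by congr col_mx; apply/matrixP => a c; rewrite !ord1 !mxE eqxx e.
Qed.

(** Induction on the corank. Below full rank some coordinate form lies outside the row space;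
    slicing by its value adds it as a row, lowers the corank by one and costs a factor [L.+1]. At
    full rank the system has at most one solution. *)
Lemma card_affine_box {n q : nat} (L : nat) (M : 'M[rat]_(q, n))
    (b : 'cV[rat]_q) :
  (#|[set k : {ffun 'I_n -> 'I_L.+1} | M *m natcol k == b]|
     <= L.+1 ^ (n - \rank M))%N.
Proof.
move: {2}(n - \rank M)%N (erefl (n - \rank M)%N) => r.
elim: r q M b => [|r IH] q M b hr; rewrite hr.
  have rf : row_full M.
    by rewrite /row_full eqn_leq rank_leq_col -subn_eq0 hr.
  rewrite expn0; apply/card_le1_eqP => k1 k2; rewrite !inE => /eqP h1 /eqP h2.
  have /(congr1 (mulmx (pinvmx M))) : M *m natcol k1 = M *m natcol k2.
    by rewrite h1 h2.
  rewrite !mulmxA mulVpmx // !mul1mx => /colP e; apply/ffunP => i.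
  by have := e i; rewrite !mxE => /eqP; rewrite eqr_nat => /eqP /val_inj.
have [j hj] : exists j : 'I_n, ~~ ((delta_mx 0 j : 'rV[rat]_n) <= M)%MS.
  apply/existsP; rewrite -negb_forall; apply/negP => /forallP h.
  have : ((1%:M : 'M[rat]_n) <= M)%MS by apply/row_subP => i; rewrite row1 h.
  by rewrite sub1mx /row_full => /eqP e; move: hr; rewrite e subnn.
have hr1 : (n - \rank (col_mx M (delta_mx 0%R j : 'rV[rat]_n)))%N = r.
  by rewrite mxrank_col_delta // subnS hr.
rewrite expnS; have <- : [set k | (M *m natcol k == b) && (k j <= L)%N] =
    [set k : {ffun 'I_n -> 'I_L.+1} | M *m natcol k == b].
  by apply/setP => k; rewrite !inE -ltnS ltn_ord andbT.
apply: card_slices => w; have := IH _ _ (col_mx b (w%:R)%:M) hr1.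
rewrite hr1; apply: leq_trans; apply: eq_leq.
by congr #|pred_of_set _|; apply/setP => k; rewrite !inE col_delta_eq.
Qed.

(** * Dual bases of maximal cones and completeness of the fan *)

Lemma pair_sum {d n : nat} (m : 'I_d -> int) (c : 'I_n -> int)
    (v : 'I_n -> 'I_d -> int) (P : pred 'I_n) :
  pair m (fun i => \sum_(rho | P rho) c rho * v rho i) =
  \sum_(rho | P rho) c rho * pair m (v rho).
Proof.
rewrite /pair; under eq_bigr do rewrite mulr_sumr.
rewrite exchange_big; apply: eq_bigr => rho _.
by rewrite mulr_sumr; apply: eq_bigr => i _; rewrite mulrCA.
Qed.

(** As [ndual] is chosen by epsilon, the content is the existence of a dual basis. The witness
    collects the [rho']-coordinates of the standard vectors; freeness gives its values on the rays
    of [sigma]. *)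
Lemma ndualP {d n : nat} (v : 'I_n -> 'I_d -> int) (sigma : {set 'I_n})
    (rho' rho : 'I_n) :
  is_Zbasis v sigma -> rho' \in sigma -> rho \in sigma ->
  pair (ndual v sigma rho') (v rho) = (rho == rho')%:Z.
Proof.
move=> [gen free] h' h.
suff ex : exists m : 'I_d -> int, forall rho, rho \in sigma ->
    pair m (v rho) = (rho == rho')%:Z.
  exact: (epsilon_spec (inhabits (fun _ => 0)) _ ex).
have [c hc] := choice (fun j : 'I_d => gen (fun i => (i == j)%:Z)).
exists (fun j => c j rho') => r hr.
have : \sum_(i < d) v r i * c i rho' - (rho' == r)%:Z = 0 :> int.
  apply: (free (fun s => \sum_(i < d) v r i * c i s - (s == r)%:Z)) => // i.
  under eq_bigr do rewrite mulrBl mulr_suml.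
  rewrite sumrB exchange_big /=; apply/eqP; rewrite subr_eq0; apply/eqP.
  rewrite [RHS](bigD1 r) //= eqxx mul1r [X in _ + X]big1 ?addr0; last first.
    by move=> s /andP[_ /negbTE->]; rewrite mul0r.
  under eq_bigr do under eq_bigr do rewrite -mulrA.
  under eq_bigr do rewrite -mulr_sumr -hc.
  rewrite (bigD1 i) //= eqxx mulr1 big1 ?addr0 // => k /negbTE.
  by rewrite eq_sym => ->; rewrite mulr0.
move/subr0_eq; rewrite /pair eq_sym => <-.
by apply: eq_bigr => i _; rewrite mulrC.
Qed.

Lemma m_sigmaP {d n : nat} (v : 'I_n -> 'I_d -> int) (sigma : {set 'I_n})
    (rho : 'I_n) :
  is_Zbasis v sigma -> rho \in sigma -> pair (m_sigma v sigma) (v rho) = 1.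
Proof.
move=> hb; move: rho.
suff ex : exists m : 'I_d -> int, forall rho, rho \in sigma ->
    pair m (v rho) = 1.
  exact: (epsilon_spec (inhabits (fun _ => 0)) _ ex).
(* The witness is the sum of the dual basis. *)
exists (fun i => \sum_(r in sigma) ndual v sigma r i) => rho h.
rewrite /pair; under eq_bigr do rewrite mulr_suml.
rewrite exchange_big /= -[RHS]addr0 (bigD1 rho) //=; congr (_ + _).
  by have := ndualP _ _ _ _ hb h h; rewrite eqxx.
rewrite big1 // => r /andP[hr hne].
have := ndualP _ _ _ _ hb hr h; rewrite /pair => ->.
by rewrite eq_sym (negbTE hne).
Qed.

(** Completeness provides only real coefficients. Pairing with the dual basis shows that they are
    integers, because [u] is integral; they are nonnegative because they come from a cone. *)
Lemma complete_nat {R : realType} {d n : nat} (v : 'I_n -> 'I_d -> int)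
    (S : {set {set 'I_n}}) (u : 'I_d -> int) :
  smooth_projective_fan R v S ->
  exists sigma (t : 'I_n -> nat), [/\ sigma \in S,
    forall rho, rho \notin sigma -> t rho = 0%N
    & forall i, u i = \sum_(rho < n) (t rho)%:Z * v rho i].
Proof.
move=> [_ [_ [hb [_ [hcov _]]]]].
have [sigma hs [c [c0 [cs hu]]]] := hcov (fun i => (u i)%:~R).
have [_ {}hb] := hb _ hs.
have hc rho : rho \in sigma -> c rho = (pair (ndual v sigma rho) u)%:~R.
  move=> hr; have e r : r \in sigma ->
      \sum_(i < d) (ndual v sigma rho i)%:~R * (c r * (v r i)%:~R) =
      c r * (r == rho)%:R.
    move=> hr'; rewrite -[(r == rho)%:R]/((r == rho)%:Z%:~R : R) -(ndualP v sigma) //.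
    rewrite /pair raddf_sum mulr_sumr; apply: eq_bigr => i _.
    by rewrite /= rmorphM /= mulrCA.
  rewrite /pair raddf_sum /=.
  under eq_bigr do rewrite rmorphM /= hu mulr_sumr.
  rewrite exchange_big /= (bigD1 rho) //= [X in _ + X]big1 ?addr0.
    by rewrite e // eqxx mulr1.
  move=> r /negbTE hne; have [hr'|/cs->] := boolP (r \in sigma).
    by rewrite e // hne mulr0.
  by rewrite big1 // => i _; rewrite mul0r mulr0.
exists sigma, (fun rho => if rho \in sigma then `|pair (ndual v sigma rho) u|%N else 0%N).
split=> // [rho /negbTE -> //|i].
apply/eqP; rewrite -(eqr_int R) hu raddf_sum; apply/eqP/eq_bigr => rho _.
rewrite /= rmorphM /=; case: ifPn => [hr|/cs-> //].
rewrite hc //; congr (_%:~R * _).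
have : 0 <= pair (ndual v sigma rho) u by rewrite -(ler0z R) -hc.
by move/gez0_abs.
Qed.

(** * Monomials evaluated at dyadic exponents *)

Lemma prod_exprz {R : fieldType} {I : finType} (P : pred I) (x : R)
    (f : I -> int) : x != 0 ->
  \prod_(i | P i) x ^ f i = x ^ (\sum_(i | P i) f i).
Proof.
move=> x0.
by rewrite (big_morph _ (fun a b : int => expfzDr a b x0) (expr0z x)).
Qed.

(** The loss [|e|] pays for negative exponents, where the lower bound must come from
    [x < 2 ^ k.+1]. *)
Lemma exprz_dyadic_ge {R : realType} (x : nat) (e : int) : (0 < x)%N ->
  2 ^ ((trunc_log 2 x)%:Z * e - `|e|) <= (x%:R : R) ^ e.
Proof.
move=> x0; have /andP[h1 h2] := trunc_log_bounds (isT : (1 < 2)%N) x0.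
set k := trunc_log 2 x in h1 h2 *.
case: e => m.
  apply: (@le_trans _ _ (2 ^ (k%:Z * m%:Z))).
    by rewrite ler_weXz2l ?ler1n // gerBl.
  rewrite -PoszM /= -!exprnP exprM; apply: lerXn2r; rewrite ?nnegrE ?exprn_ge0 //.
  by rewrite -natrX ler_nat.
have -> : k%:Z * Negz m - `|Negz m| = - ((k.+1 * m.+1)%N%:Z).
  by rewrite NegzE normrN; lia.
rewrite NegzE -!exprnN lef_pV2 ?posrE ?exprn_gt0 ?ltr0n //.
rewrite exprM; apply: lerXn2r; rewrite ?nnegrE ?exprn_ge0 //.
by rewrite -natrX ler_nat ltnW.
Qed.

(** This serves the exponents of [XD0], nonnegative by [antican_gg]: they suffer no rounding loss,
    so that [2 ^ D <= B] holds without a constant. *)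
Lemma exprz_dyadic_ge_nneg {R : realType} (x : nat) (e : int) : (0 < x)%N ->
  0 <= e -> 2 ^ ((trunc_log 2 x)%:Z * e) <= (x%:R : R) ^ e.
Proof.
move=> x0; have /andP[h1 h2] := trunc_log_bounds (isT : (1 < 2)%N) x0.
case: e => // m _.
rewrite -PoszM /= -!exprnP exprM; apply: lerXn2r; rewrite ?nnegrE ?exprn_ge0 //.
by rewrite -natrX ler_nat.
Qed.

(* [t] expresses [- sum k n_rho] in a cone [tau] containing it; the last clause
   is the evaluation of [D_0(tau)] at [k]. *)
Lemma complement_cone {R : realType} {d n : nat} (v : 'I_n -> 'I_d -> int)
    (S : {set {set 'I_n}}) (k : 'I_n -> nat) :
  smooth_projective_fan R v S ->
  exists tau (t : 'I_n -> nat), [/\ tau \in S,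
    forall i, \sum_(rho < n) (k rho + t rho)%N%:Z * v rho i = 0
    & \sum_(rho < n) (k rho)%:Z * a_coef v tau rho =
      (\sum_(rho < n) k rho + \sum_(rho < n) t rho)%N%:Z].
Proof.
move=> hfan.
have [tau [t [htau ht hu]]] :=
  complete_nat v S (fun i => - \sum_(rho < n) (k rho)%:Z * v rho i) hfan.
have hb : is_Zbasis v tau by case: hfan => _ [_ [/(_ _ htau)[_ //] _]].
exists tau, t; split=> // [i|].
  under eq_bigr do rewrite PoszD mulrDl.
  by rewrite big_split /= -hu subrr.
rewrite /a_coef; under eq_bigr do rewrite mulrBr mulr1.
rewrite sumrB -pair_sum PoszD !raddf_sum /=; congr (_ + _).
have -> : \sum_(rho < n) (t rho)%:Z =
    \sum_(rho < n) (t rho)%:Z * pair (m_sigma v tau) (v rho).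
  apply: eq_bigr => rho _; have [h|h] := boolP (rho \in tau).
    by rewrite m_sigmaP // mulr1.
  by rewrite ht // mul0r.
rewrite -pair_sum /pair; apply: eq_bigr => i _.
by rewrite -mulrN hu.
Qed.

(** Pair the relation with [ndual v sigma rho']: among the rays of [sigma] only [rho'] contributes
    to the [k]-part, and the rays outside [sigma] form the exponent on the left. *)
Lemma dual_exponent {d n : nat} (v : 'I_n -> 'I_d -> int)
    (sigma : {set 'I_n}) (rho' : 'I_n) (k t : 'I_n -> nat) :
  is_Zbasis v sigma -> rho' \in sigma ->
  (forall i, \sum_(rho < n) (k rho + t rho)%N%:Z * v rho i = 0) ->
  \sum_(rho < n | rho \notin sigma)
    (k rho)%:Z * - pair (ndual v sigma rho') (v rho) =
  (k rho')%:Z + \sum_(rho < n) (t rho)%:Z * pair (ndual v sigma rho') (v rho).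
Proof.
move=> hb h' hkt.
set e := fun rho => pair (ndual v sigma rho') (v rho).
have : \sum_(rho < n) (k rho + t rho)%N%:Z * e rho = 0.
  by rewrite -pair_sum /pair big1 // => i _; rewrite hkt mulr0.
under eq_bigr do rewrite PoszD mulrDl.
rewrite big_split /= [X in X + _ = _](bigID (mem sigma)) /=.
have -> : \sum_(rho < n | rho \in sigma) (k rho)%:Z * e rho = (k rho')%:Z.
  rewrite (bigD1 rho') //= big1 ?addr0 /e.
    by rewrite (ndualP v sigma) // eqxx mulr1.
  by move=> r /andP[hr /negbTE hne]; rewrite (ndualP v sigma) // hne mulr0.
under [X in _ -> X = _]eq_bigr do rewrite mulrN.
by rewrite sumrN addrAC => /eqP; rewrite addr_eq0 => /eqP ->.
Qed.

Lemma ndual_bounded {d n : nat} (v : 'I_n -> 'I_d -> int) :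
  exists c : nat, forall sigma rho' rho,
    (`|pair (ndual v sigma rho') (v rho)| <= c)%N.
Proof.
exists (\max_(sigma : {set 'I_n}) \max_(rho' < n) \max_(rho < n)
  `|pair (ndual v sigma rho') (v rho)|%N) => sigma rho' rho.
apply: leq_trans (leq_bigmax sigma); apply: leq_trans (leq_bigmax rho').
exact: leq_bigmax.
Qed.

Lemma not_flat_dyadic {R : realType} {d n : nat} (v : 'I_n -> 'I_d -> int)
    (S : {set {set 'I_n}}) (c : nat) (A B : R) (X : {ffun 'I_n -> nat}) :
  smooth_projective_fan R v S -> antican_gg v S ->
  (forall sigma rho' rho, (`|pair (ndual v sigma rho') (v rho)| <= c)%N) ->
  inA v S B X -> ~ inAflat v S A B X ->
  exists rho' (t : 'I_n -> nat),
  [/\ forall i, \sum_(rho < n) (trunc_log 2 (X rho) + t rho)%N%:Z * v rho i = 0,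
      2 ^+ (\sum_(rho < n) trunc_log 2 (X rho) + \sum_(rho < n) t rho)%N <= B
    & 2 ^+ trunc_log 2 (X rho') <=
      2 ^+ (c * (n + \sum_(rho < n) t rho))%N * (ln B) `^ A].
Proof.
move=> hfan hgg hc hX hnot; have [X0 hB] := hX.
set k := fun rho => trunc_log 2 (X rho).
have [tau [t [htau ht hD]]] := complement_cone v S k hfan.
have [sigma [hs [rho' [hr hlt]]]] : exists sigma, sigma \in S /\
    exists rho', rho' \in sigma /\ XE R v sigma rho' X < (ln B) `^ A.
  apply: contrapT => hno; apply: hnot; split=> // sigma hs rho' hr.
  by rewrite leNgt; apply/negP => h; apply: hno; exists sigma; split=> //; exists rho'.
have hb : is_Zbasis v sigma by case: hfan => _ [_ [/(_ _ hs)[_ //] _]].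
have two0 : (2 : R) != 0 by rewrite pnatr_eq0.
exists rho', t; split=> //.
  apply: le_trans (hB _ htau); rewrite /XD0.
  rewrite exprnP -hD -prod_exprz //; apply: ler_prod => rho _.
  by rewrite exprz_ge0 //= exprz_dyadic_ge_nneg // hgg.
(* Two errors separate this exponent from [k rho']: the rounding term [e2], at most [c * n], and the
   term [e1] linear in [t], at least [- c * |t|]. Together they give the exponent
   [c * (n + |t|)]. *)
have hE : 2 ^ (\sum_(rho < n | rho \notin sigma)
    ((k rho)%:Z * - pair (ndual v sigma rho') (v rho)
     - `|- pair (ndual v sigma rho') (v rho)|)) <= XE R v sigma rho' X.
  rewrite -prod_exprz //; apply: ler_prod => rho _.
  by rewrite exprz_ge0 //= exprz_dyadic_ge.
have := le_trans hE (ltW hlt).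
rewrite sumrB (dual_exponent v sigma rho' k t) //.
set e1 := \sum_(rho < n) _ * _; set e2 := \sum_(rho < n | _) _.
have he1 : - ((c * \sum_(rho < n) t rho)%N%:Z) <= e1.
  rewrite big_distrr /= raddf_sum /= -sumrN; apply: ler_sum => rho _.
  rewrite mulnC PoszM -mulrN; apply: ler_wpM2l => //.
  by have := hc sigma rho' rho; lia.
have he2 : e2 <= (c * n)%N%:Z.
  rewrite mulnC -[n in leRHS]card_ord -sum_nat_const raddf_sum /= /e2 big_mkcond /=.
  by apply: ler_sum => rho _; case: ifP => // _; have := hc sigma rho' rho; lia.
move=> h; rewrite -ler_pdivrMl ?exprn_gt0 //; apply: le_trans h.
rewrite exprnN exprnP -expfzDr // ler_weXz2l ?ler1n //.
rewrite -/(k rho') mulnDr PoszD; lia.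
Qed.

(** * Independence of the degree and the ray forms *)

Definition raymx {d n : nat} (v : 'I_n -> 'I_d -> int) : 'M[rat]_(d, n) :=
  \matrix_(i, rho) (v rho i)%:~R.

(** The rows are the [d + 1] linear forms whose values at [k] are fixed by [D] and [t]: the degree,
    then the coordinates of the weighted sum of the rays. *)
Definition degmx {d n : nat} (v : 'I_n -> 'I_d -> int) : 'M[rat]_(1 + d, n) :=
  col_mx (const_mx 1) (raymx v).

Lemma raymx_relation {d n : nat} (v : 'I_n -> 'I_d -> int) (m : 'rV[rat]_d)
    (a : 'I_n -> int) :
  (forall i, \sum_(rho < n) a rho * v rho i = 0) ->
  \sum_(rho < n) (a rho)%:~R * (m *m raymx v) 0 rho = 0.
Proof.
move=> ha; under eq_bigr do rewrite mxE mulr_sumr.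
rewrite exchange_big big1 //= => i _.
under eq_bigr do rewrite mxE mulrCA -rmorphM.
by rewrite -mulr_sumr -raddf_sum /= ha mulr0.
Qed.

(** Write the opposite of the ray in a cone containing it. The resulting relation is nonnegative and
    has a positive coefficient at [rho']; it separates the degree from the ray forms. *)
Lemma opposite_ray {R : realType} {d n : nat} (v : 'I_n -> 'I_d -> int)
    (S : {set {set 'I_n}}) (rho' : 'I_n) :
  smooth_projective_fan R v S ->
  exists t : 'I_n -> nat,
    forall i, \sum_(rho < n) (t rho + (rho == rho'))%N%:Z * v rho i = 0.
Proof.
move=> hfan.
have [_ [t [_ _ ht]]] := complete_nat v S (fun i => - v rho' i) hfan.
exists t => i; under eq_bigr do rewrite PoszD mulrDl.
rewrite big_split /= -ht (bigD1 rho') //= eqxx mul1r big1 ?addr0 ?addNr //.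
by move=> r /negbTE ->; rewrite mul0r.
Qed.

Lemma row_degmxE {d n : nat} (v : 'I_n -> 'I_d -> int)
    (u : 'rV[rat]_(1 + d)) (rho : 'I_n) :
  (u *m degmx v) 0 rho = lsubmx u 0 0 + (rsubmx u *m raymx v) 0 rho.
Proof.
rewrite -{1}[u]hsubmxK mul_row_col [LHS]mxE; congr (_ + _).
by rewrite mxE big_ord1 [const_mx _ _ _]mxE mulr1.
Qed.

(** A vanishing combination of the rows is a constant [al] plus a linear form equal to [- al] on
    every ray. A nonnegative nonzero relation among the rays forces [al = 0], and then the linear
    form vanishes on a basis. *)
Lemma mxrank_degmx {R : realType} {d n : nat} (v : 'I_n -> 'I_d -> int)
    (S : {set {set 'I_n}}) (rho' : 'I_n) :
  smooth_projective_fan R v S -> \rank (degmx v) = d.+1.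
Proof.
move=> hfan; apply/eqP/inj_row_free => u hu.
set al := lsubmx u 0 0; set f := fun rho => (rsubmx u *m raymx v) 0 rho.
have hf rho : f rho = - al.
  have := row_degmxE v u rho; rewrite hu mxE => /esym/eqP.
  by rewrite addrC addr_eq0 => /eqP.
have al0 : al = 0.
  have [t /(raymx_relation v (rsubmx u))] := opposite_ray v S rho' hfan.
  under eq_bigr do rewrite -/(f _) hf.
  rewrite -mulr_suml => /eqP; rewrite mulrN oppr_eq0 mulf_eq0 => /orP[|/eqP //].
  rewrite -raddf_sum /= -raddf_sum /= intr_eq0 eqz_nat (bigD1 rho') //=.
  by rewrite eqxx addn1.
have [sigma hs hr] : exists2 sigma, sigma \in S & rho' \in sigma.
  by case: hfan => _ [].
have [gen _] : is_Zbasis v sigma by case: hfan => _ [_ [/(_ _ hs)[_ //] _]].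
rewrite -[u]hsubmxK -[RHS]row_mx0; congr row_mx; apply/rowP => i.
  by rewrite [i]ord1 -/al al0 mxE.
(* Expanding the standard vector [i] in the basis isolates the coordinate [i] of the linear form. *)
have [c hc] := gen (fun j => (j == i)%:Z).
have : \sum_(rho in sigma) (c rho)%:~R * f rho = 0.
  by rewrite big1 // => r _; rewrite hf al0 oppr0 mulr0.
rewrite /f; under eq_bigr do rewrite mxE mulr_sumr.
rewrite exchange_big /=.
under eq_bigr do under eq_bigr do rewrite [raymx _ _ _]mxE mulrCA -rmorphM.
under eq_bigr do rewrite -mulr_sumr -raddf_sum /= -hc.
rewrite (bigD1 i) //= eqxx mulr1 big1 ?addr0 => [->|]; first by rewrite [RHS]mxE.
by move=> j /negbTE ->; rewrite mulr0.
Qed.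

(** * Dyadic boxes: counting exponents, then points *)

Definition dyadic_box {d n : nat} (v : 'I_n -> 'I_d -> int) (rho' : 'I_n)
    (L D W : nat) (t : 'I_n -> nat) : {set {ffun 'I_n -> 'I_L.+1}} :=
  [set k : {ffun 'I_n -> 'I_L.+1} |
    [&& (\sum_(rho < n) k rho + \sum_(rho < n) t rho == D)%N,
        [forall i, \sum_(rho < n) (k rho + t rho)%N%:Z * v rho i == 0]
      & (k rho' <= W)%N]].

(* The factor [D.+1] puts the two cases, [rho'] independent of or dependent on
   the rows of [degmx v], in a common form. *)
Lemma card_dyadic_box {R : realType} {d n : nat} (v : 'I_n -> 'I_d -> int)
    (S : {set {set 'I_n}}) (rho' : 'I_n) :
  smooth_projective_fan R v S ->
  exists C : nat, forall (L D W : nat) (t : 'I_n -> nat), (D <= L)%N ->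
  (#|dyadic_box v rho' L D W t| * D.+1
   <= C * (1 + W + \sum_(rho < n) t rho) * L.+1 ^ (n - d.+1))%N.
Proof.
move=> hfan; set M := degmx v.
have rkM : \rank M = d.+1 := mxrank_degmx v S rho' hfan.
(* The values that [degmx v] takes at every [k] of the box. *)
pose b (D : nat) (t : 'I_n -> nat) : 'cV[rat]_(1 + d) :=
  col_mx (D%:R - (\sum_(rho < n) t rho)%N%:R)%:M
    (\col_i - \sum_(rho < n) (t rho)%:R * (v rho i)%:~R).
pose K L D W t := [set k : {ffun 'I_n -> 'I_L.+1} |
  (M *m natcol k == b D t) && (k rho' <= W)%N].
have sub L D W (t : 'I_n -> nat) : dyadic_box v rho' L D W t \subset K L D W t.
  apply/fintype.subsetP => k; rewrite !inE => /and3P[/eqP hD /forallP hv ->].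
  rewrite andbT mul_col_mx; apply/eqP; congr col_mx; apply/colP => i.
    rewrite [i]ord1 !mxE eqxx mulr1n -hD natrD addrK natr_sum.
    by apply: eq_bigr => j _; rewrite !mxE mul1r.
  rewrite !mxE; apply/eqP; rewrite -addr_eq0 -big_split /=.
  have /eqP/(congr1 (fun z : int => z%:~R : rat)) := hv i.
  rewrite raddf_sum /= => e; apply/eqP; apply: etrans e; apply: eq_bigr => j _.
  by rewrite !mxE rmorphM /= PoszD rmorphD /= mulrDl mulrC.
have [dep|indep] := boolP ((delta_mx 0 rho' : 'rV[rat]_n) <= M)%MS; last first.
  have rk2 := mxrank_col_delta M rho' indep.
  exists 1%N => L D W t hD; rewrite mul1n.
  have dn : (d.+2 <= n)%N by rewrite -rkM -rk2 rank_leq_col.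
  have -> : (n - d.+1 = (n - d.+2).+1)%N by lia.
  rewrite expnS mulnA mulnAC; apply: leq_mul; last exact: hD.
  apply: leq_trans (subset_leq_card (sub _ _ _ _)) _.
  apply: (@leq_trans (W.+1 * L.+1 ^ (n - d.+2))); last by rewrite leq_mul2r; lia.
  apply: card_slices => w.
  have := card_affine_box L (col_mx M (delta_mx 0 rho' : 'rV[rat]_n))
    (col_mx (b D t) (w%:R)%:M).
  rewrite rk2 rkM; apply: leq_trans; apply: eq_leq.
  by congr #|pred_of_set _|; apply/setP => k; rewrite !inE col_delta_eq.
have [u hu] := submxP dep.
set al := lsubmx u 0 0; set f := fun rho => (rsubmx u *m raymx v) 0 rho.
have hf rho : (rho == rho')%:R = al + f rho.
  by have := row_degmxE v u rho; rewrite -hu mxE eqxx.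
(* If [al] vanished, the indicator of [rho'] would be a linear form on the rays; the relation of
   [opposite_ray] would then give [t rho' + 1 = 0]. *)
have al0 : al != 0.
  apply/eqP => al0.
  have [t /(raymx_relation v (rsubmx u))] := opposite_ray v S rho' hfan.
  under eq_bigr => rho _ do rewrite -/(f rho) -[f rho]add0r -al0 -hf.
  rewrite (bigD1 rho') //= eqxx mulr1 big1 ?addr0; last first.
    by move=> r /negbTE ->; rewrite mulr0.
  by move/eqP; rewrite intr_eq0 addn1.
pose c := \sum_(rho < n) `|f rho|.
have c0 : 0 <= c by apply: sumr_ge0.
set C := Num.bound (1 + `|al^-1| * (1 + c)).
have hC : 1 + `|al^-1| * (1 + c) <= C%:R.
  by apply/ltW/archi_boundP; rewrite addr_ge0 // mulr_ge0 // addr_ge0.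
exists C => L D W t hD.
(* A single member [k] of the box already bounds [D] in terms of [W] and [t], by solving for its
   degree in [hk] below. *)
have [->|[k hk]] := set_0Vmem (dyadic_box v rho' L D W t).
  by rewrite cards0.
rewrite mulnC; apply: leq_mul; last first.
  apply: leq_trans (subset_leq_card (sub _ _ _ _)) _; rewrite -rkM.
  apply: leq_trans (card_affine_box L M (b D t)); apply: subset_leq_card.
  by apply/fintype.subsetP => x; rewrite !inE => /andP[].
move: hk; rewrite inE => /and3P[/eqP <- /forallP hv hW].
set T := (\sum_(rho < n) t rho)%N.
have hrel : \sum_(rho < n) (k rho + t rho)%N%:R * f rho = 0.
  exact: (raymx_relation v (rsubmx u) (fun rho => (k rho + t rho)%N)
            (fun i => eqP (hv i))).
have hk : (\sum_(rho < n) k rho)%N%:R =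
    al^-1 * ((k rho')%:R + \sum_(rho < n) (t rho)%:R * f rho).
  apply: (mulfI al0); rewrite mulVKf //.
  have -> : (k rho')%:R = \sum_(rho < n) (k rho)%:R * (rho == rho')%:R :> rat.
    rewrite (bigD1 rho') //= eqxx mulr1 big1 ?addr0 // => r /negbTE ->.
    by rewrite mulr0.
  under [X in _ = X + _]eq_bigr do rewrite hf mulrDr.
  rewrite big_split /= -addrA -big_split /=.
  under [X in _ = _ + X]eq_bigr do rewrite -mulrDl -natrD.
  by rewrite hrel addr0 natr_sum mulr_sumr; apply: eq_bigr => r _; rewrite mulrC.
have htf : `|\sum_(rho < n) (t rho)%:R * f rho| <= T%:R * c.
  apply: le_trans (ler_norm_sum _ _ _) _.
  rewrite /T natr_sum mulr_suml; apply: ler_sum => r _.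
  rewrite normrM normr_nat ler_wpM2l // /c (bigD1 r) //= lerDl.
  exact: sumr_ge0.
have hk2 : (\sum_(rho < n) k rho)%N%:R <= `|al^-1| * (W%:R + T%:R * c).
  rewrite -[leLHS]normr_nat hk normrM ler_wpM2l //.
  apply: le_trans (ler_normD _ _) _; rewrite normr_nat.
  by apply: lerD; rewrite ?ler_nat.
rewrite -(ler_nat rat) natrM -addn1 !natrD.
apply: (@le_trans _ _ ((1 + `|al^-1| * (1 + c)) * (1 + W%:R + T%:R))); last first.
  by rewrite ler_wpM2r // !addr_ge0.
have W0 : 0 <= W%:R :> rat by []. 
have T0 : 0 <= T%:R :> rat by [].
have a0 := normr_ge0 al^-1.
have := mulr_ge0 a0 T0; have := mulr_ge0 (mulr_ge0 a0 c0) W0.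
have := mulr_ge0 a0 c0.
rewrite -/T; nra.
Qed.

(* Reduction modulo [2 ^ k] is injective on [[2 ^ k, 2 ^ k.+1)]. *)
Lemma size_dyadic_class {n : nat} (k : 'I_n -> nat)
    (s : seq {ffun 'I_n -> nat}) :
  uniq s ->
  (forall X, X \in s -> forall rho, (0 < X rho)%N /\ trunc_log 2 (X rho) = k rho) ->
  (size s <= 2 ^ \sum_(rho < n) k rho)%N.
Proof.
move=> us hs.
have pos rho : (0 < 2 ^ k rho)%N by rewrite expn_gt0.
pose F (X : {ffun 'I_n -> nat}) : {dffun forall rho, 'I_(2 ^ k rho)} :=
  [ffun rho => Ordinal (ltn_pmod (X rho) (pos rho))].
have X_mod (X : {ffun 'I_n -> nat}) rho : X \in s ->
    X rho = (X rho %% 2 ^ k rho + 2 ^ k rho)%N.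
  move=> /hs /(_ rho) [X0 hk].
  have /andP[h1 h2] := trunc_log_bounds (isT : (1 < 2)%N) X0.
  rewrite hk in h1 h2; rewrite -{2}(subnK h1) modnDr modn_small ?subnK //.
  by move: h2; rewrite expnS; lia.
have injF : {in s &, injective F}.
  move=> X Y hX hY /ffunP e; apply/ffunP => rho.
  rewrite X_mod // [RHS]X_mod //; congr (_ + _)%N.
  by have /(congr1 val) := e rho; rewrite !ffunE.
have uF : uniq (map F s) by rewrite map_inj_in_uniq.
rewrite -(size_map F) -(card_uniqP uF); apply: leq_trans (max_card _) _.
rewrite card_dep_ffun foldrE big_map big_enum expn_sum /=.
by apply: eq_leq; apply: eq_bigr => rho _; rewrite card_ord.
Qed.

(** Double counting: each point is charged to at least one quadruple [(rho', t, D, k)], and after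
    exchanging the sums each [k] carries at most [2 ^ |k|] points, where [|k| = D - |t|]. *)
Lemma size_le_dyadic {d n : nat} (v : 'I_n -> 'I_d -> int) (L : nat)
    (W : nat -> nat) (s : seq {ffun 'I_n -> nat}) :
  uniq s ->
  (forall X, X \in s -> (forall rho, (0 < X rho)%N) /\
    exists rho' (t : 'I_n -> nat),
    [/\ forall i, \sum_(rho < n) (trunc_log 2 (X rho) + t rho)%N%:Z * v rho i = 0,
      (\sum_(rho < n) trunc_log 2 (X rho) + \sum_(rho < n) t rho <= L)%N
    & (trunc_log 2 (X rho') <= W (\sum_(rho < n) t rho))%N]) ->
  (size s <= \sum_(rho' < n) \sum_(t : {ffun 'I_n -> 'I_L.+1}) \sum_(D < L.+1)
    2 ^ (D - \sum_(rho < n) t rho) *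
    #|dyadic_box v rho' L D (W (\sum_(rho < n) t rho)) (fun r => t r)|)%N.
Proof.
move=> us hs.
pose cls (X : {ffun 'I_n -> nat}) (k : {ffun 'I_n -> 'I_L.+1}) :=
  [forall rho, trunc_log 2 (X rho) == k rho].
apply: (@leq_trans (\sum_(X <- s) \sum_(rho' < n)
    \sum_(t : {ffun 'I_n -> 'I_L.+1}) \sum_(D < L.+1)
    \sum_(k in dyadic_box v rho' L D (W (\sum_(rho < n) t rho)) (fun r => t r))
    cls X k)).
  rewrite -sum1_size big_seq_cond [leqRHS]big_seq_cond.
  apply: leq_sum => X; rewrite andbT => /hs [X0 [rho' [t [hrel hL hW]]]].
  (* The bound [|k| + |t| <= L] confines every coordinate of [k] and [t] to the finite index
     types. *)
  have kb rho : (trunc_log 2 (X rho) < L.+1)%N.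
    by move: hL; rewrite (bigD1 rho) //=; lia.
  have tb rho : (t rho < L.+1)%N.
    by move: hL; rewrite [X in (_ + X <= _)%N](bigD1 rho) //=; lia.
  pose tt := [ffun rho => Ordinal (tb rho)].
  pose kk := [ffun rho => Ordinal (kb rho)].
  have ett : (\sum_(rho < n) tt rho)%N = (\sum_(rho < n) t rho)%N.
    by apply: eq_bigr => r _; rewrite ffunE.
  have ekk : (\sum_(rho < n) kk rho)%N = (\sum_(rho < n) trunc_log 2 (X rho))%N.
    by apply: eq_bigr => r _; rewrite ffunE.
  rewrite (bigD1 rho') //= (bigD1 tt) //= (bigD1 (Ordinal (hL : (_ < L.+1)%N))) //=.
  rewrite (bigD1 kk) /=.
    suff -> : cls X kk by lia.
    by apply/forallP => r; rewrite ffunE.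
  rewrite inE ett ekk eqxx ffunE /= hW andbT; apply/forallP => i.
  by apply/eqP; rewrite -[RHS](hrel i); apply: eq_bigr => r _; rewrite !ffunE.
rewrite exchange_big /=; apply: leq_sum => rho' _.
rewrite exchange_big /=; apply: leq_sum => t _.
rewrite exchange_big /=; apply: leq_sum => D _.
rewrite exchange_big /= mulnC -sum_nat_const; apply: leq_sum => k.
rewrite inE => /and3P[/eqP <- _ _]; rewrite addnK.
have -> : (\sum_(X <- s) cls X k)%N = size [seq X <- s | cls X k].
  rewrite size_filter -sum1_count [RHS]big_mkcond; apply: eq_bigr => X _.
  by case: (cls X k).
apply: size_dyadic_class => [|X]; first exact: filter_uniq.
rewrite mem_filter => /andP[/forallP hX /hs [X0 _]] rho.
by split; [exact: X0|apply/eqP].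
Qed.

(** * Summation over [D] and [t] *)

Lemma sum_expn_div_le {R : realType} (L : nat) :
  \sum_(D < L.+1) 2 ^+ D / D.+1%:R <= 4 * 2 ^+ L / L.+1%:R :> R.
Proof.
elim: L => [|L IH]; first by rewrite big_ord1 /= expr0; lra.
(* The step from 0 to 1 is checked directly, since the difference computed below would be negative
   there. *)
rewrite big_ord_recr /=; case: L IH => [|L] IH.
  by rewrite big_ord1 /= expr0 expr1; lra.
apply: le_trans (lerD IH (lexx _)) _.
rewrite (exprS _ L.+1); set x := 2 ^+ L.+1; have x0 : 0 <= x by rewrite exprn_ge0.
rewrite -[leLHS]/(4 * x / L.+2%:R + 2 * x / L.+3%:R).
rewrite -subr_ge0.
have l0 : 0 <= L%:R :> R by [].
have -> : 4 * (2 * x) / L.+3%:R - (4 * x / L.+2%:R + 2 * x / L.+3%:R)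
   = x * (2 * L%:R) / (L.+2%:R * L.+3%:R) :> R.
  rewrite -[L.+3%:R]natr1 -[L.+2%:R]natr1 -[L.+1%:R]natr1; field.
  by apply/andP; split; apply: lt0r_neq0; lra.
by rewrite !mulr_ge0 // invr_ge0 mulr_ge0.
Qed.

Lemma sum_arith_geom_le {R : realType} (m : nat) :
  \sum_(j < m) j.+1%:R / 2 ^+ j <= 4 :> R.
Proof.
have -> : \sum_(j < m) j.+1%:R / 2 ^+ j = 4 - (2 * m + 4)%:R / 2 ^+ m :> R.
  elim: m => [|m IH]; first by rewrite big_ord0 expr0; lra.
  rewrite big_ord_recr /= IH exprS !natrD !natrM -natr1.
  by field; rewrite expf_neq0.
by rewrite gerBl divr_ge0 // exprn_ge0.
Qed.

(** Since [1 + |t|] is at most the product of the [1 + t rho], the sum is dominated by a product of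
    [n] one-variable series. *)
Lemma sum_box_geom_le {R : realType} (n m : nat) :
  \sum_(t : {ffun 'I_n -> 'I_m})
    (1 + \sum_(rho < n) t rho)%N%:R / 2 ^+ (\sum_(rho < n) t rho)%N
  <= 4 ^+ n :> R.
Proof.
apply: (@le_trans _ _ (\prod_(rho < n) \sum_(j < m) j.+1%:R / 2 ^+ j)).
  rewrite bigA_distr_bigA /=; apply: ler_sum => t _.
  rewrite prodf_div prodrXr -natr_prod ler_wpM2r ?invr_ge0 ?exprn_ge0 //.
  rewrite ler_nat; apply: (big_ind2 (fun a b => 1 + a <= b)%N) => //.
    by move=> a1 b1 a2 b2 h1 h2; nia.
rewrite -[n in leRHS]card_ord -prodr_const; apply: ler_prod => rho _.
rewrite sum_arith_geom_le andbT; apply: sumr_ge0 => j _.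
by rewrite divr_ge0 // exprn_ge0.
Qed.

Lemma dyadic_count {R : realType} {d n : nat} (v : 'I_n -> 'I_d -> int)
    (S : {set {set 'I_n}}) (c : nat) :
  smooth_projective_fan R v S ->
  exists K : nat, forall (L w : nat) (s : seq {ffun 'I_n -> nat}), uniq s ->
  (forall X, X \in s -> (forall rho, (0 < X rho)%N) /\
    exists rho' (t : 'I_n -> nat),
    [/\ forall i, \sum_(rho < n) (trunc_log 2 (X rho) + t rho)%N%:Z * v rho i = 0,
      (\sum_(rho < n) trunc_log 2 (X rho) + \sum_(rho < n) t rho <= L)%N
    & (trunc_log 2 (X rho') <= w + c * (n + \sum_(rho < n) t rho))%N]) ->
  (size s)%:R <= K%:R * (w.+1%:R * L.+1%:R ^+ (n - d.+1) * (2 ^+ L / L.+1%:R)) :> R.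
Proof.
move=> hfan.
have [C hC] := choice (fun rho' => card_dyadic_box v S rho' hfan).
(* Chosen so that [1 + W + T <= C' * w.+1 * (1 + T)] for [W = w + c * (n + T)]. In the witness
   below, [4 ^ n] comes from the sum over [t] and the last [4] from the sum over [D]. *)
pose C' := (1 + c * n + c)%N.
exists (\sum_(rho' < n) C rho' * C' * 4 ^ n * 4)%N => L w s us hs.
have := size_le_dyadic v L (fun T => w + c * (n + T))%N s us hs.
rewrite -(ler_nat R) => /le_trans; apply.
rewrite !natr_sum mulr_suml; apply: ler_sum => rho' _.
set Q := L.+1%:R ^+ (n - d.+1); set E := 2 ^+ L / L.+1%:R.
apply: (@le_trans _ _ (\sum_(t : {ffun 'I_n -> 'I_L.+1}) \sum_(D < L.+1)
  ((C rho' * C')%:R * w.+1%:R * Q) *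
  ((1 + \sum_(rho < n) t rho)%N%:R / 2 ^+ (\sum_(rho < n) t rho)%N) *
  (2 ^+ D / D.+1%:R))).
  rewrite natr_sum; apply: ler_sum => t _.
  rewrite natr_sum; apply: ler_sum => D _.
  set T := (\sum_(rho < n) t rho)%N.
  have Q0 : 0 <= Q by rewrite exprn_ge0.
  (* For [D < T] the subtraction [D - T] is truncated, but the box is empty. *)
  have [TD|DT] := leqP T D; last first.
    have -> : dyadic_box v rho' L D (w + c * (n + T)) (fun r => t r) = finset.set0.
      apply/setP => k; rewrite !inE; apply/negbTE/negP => /andP[/eqP h _].
      by move: h; rewrite -/T; lia.
    rewrite cards0 muln0.
    by rewrite !mulr_ge0 // ?invr_ge0 ?exprn_ge0.
  have hN := hC rho' L D (w + c * (n + T))%N (fun r => t r) (ltn_ord D).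
  rewrite -/T in hN; set N := #|_| in hN *.
  have hN' : (N * D.+1 <= C rho' * C' * w.+1 * (1 + T) * L.+1 ^ (n - d.+1))%N.
    apply: leq_trans hN _; rewrite leq_mul2r; apply/orP; right.
    rewrite -!mulnA leq_mul2l; apply/orP; right; rewrite /C'; nia.
  have hNR : N%:R <= (C rho' * C')%:R * w.+1%:R * Q * (1 + T)%N%:R / D.+1%:R :> R.
    rewrite ler_pdivlMr ?ltr0n // /Q -natrX -!natrM ler_nat.
    by apply: leq_trans hN' _; rewrite mulnAC.
  rewrite natrM natrX expfB_cond ?pnatr_eq0 //.
  apply: le_trans (ler_wpM2l _ hNR) _.
    by rewrite divr_ge0 // exprn_ge0.
  rewrite le_eqVlt; apply/predU1P; left; field.
  by rewrite addrC natr1 pnatr_eq0 expf_neq0 ?pnatr_eq0.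
under eq_bigr do rewrite -mulr_sumr.
rewrite -mulr_suml -mulr_sumr !natrM.
have := @sum_expn_div_le R L; have := @sum_box_geom_le R n L.+1.
set S1 := \sum_(t : {ffun _}) _; set S2 := \sum_(D < _) _ => h1 h2.
rewrite -[4 * 2 ^+ L / L.+1%:R]mulrA -/E in h2.
have S10 : 0 <= S1.
  by apply: sumr_ge0 => t _; rewrite divr_ge0 // exprn_ge0.
have S20 : 0 <= S2.
  by apply: sumr_ge0 => t _; rewrite divr_ge0 // exprn_ge0.
have Q0 : 0 <= Q by rewrite exprn_ge0.
apply: (@le_trans _ _ (((C rho')%:R * C'%:R * w.+1%:R * Q) * (4 ^+ n * (4 * E)))).
  rewrite -mulrA ler_wpM2l ?mulr_ge0 //; exact: ler_pM.
rewrite natrX; rewrite le_eqVlt; apply/predU1P; left; ring.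
Qed.

(** * Choice of parameters and the final estimate *)

Theorem theorem5p1 (R : realType) (d n : nat) (v : 'I_n -> 'I_d -> int)
  (S : {set {set 'I_n}})
  (hfan : smooth_projective_fan R v S) (hgg : antican_gg v S)
  (A : R) (hA : 0 < A) :
  exists C B0 : R, 0 < C /\
    forall B : R, B0 <= B ->
    forall s : seq {ffun 'I_n -> nat}, uniq s ->
      (forall X, X \in s -> inA v S B X /\ ~ inAflat v S A B X) ->
      (size s)%:R <= C * (B * ((ln B) ^ (n%:Z - d%:Z - 2) * ln (ln B))).
Proof.
have [c hc] := ndual_bounded v.
have [K hK] := dyadic_count v S c hfan.
set p : R := ln 2; have p0 : 0 < p by rewrite ln_gt0 // ltr1n.
set N := (n - d.+1)%N.
(* The factors bound, in order, [w.+1] by [ll], the [N] powers of [L.+1] by [l], and [1 / L.+1] by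
   [p / l]. *)
pose C := K%:R * (A / p + 2) * (p^-1 + 1) ^+ N * p.
have C0 : 0 <= C.
  rewrite !mulr_ge0 ?exprn_ge0 ?addr_ge0 ?mulr_ge0 ?invr_ge0 //; exact: ltW.
(* Adding 1 secures strict positivity, [C] being only nonnegative; the threshold makes [ln (ln B)]
   at least 1. *)
exists (C + 1), (expR (expR 1)); split=> [|B hB s us hs].
  by rewrite ltr_wpDl.
have B0 : 0 < B by apply: lt_le_trans hB; exact: expR_gt0.
set l := ln B; have hl : expR 1 <= l.
  by rewrite -[leLHS]expRK ler_ln // posrE ?expR_gt0.
have l0 : 0 < l by apply: lt_le_trans hl; exact: expR_gt0.
have l1 : 1 <= l.
  by apply: le_trans hl; apply: le_trans (expR_ge1Dx 1); rewrite lerDl.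
set ll := ln l; have ll1 : 1 <= ll.
  by rewrite -[leLHS]expRK ler_ln // posrE ?expR_gt0.
have ll0 : 0 < ll by apply: lt_le_trans ll1.
have rhs0 : 0 <= B * (l ^ (n%:Z - d%:Z - 2) * ll).
  by rewrite !mulr_ge0 ?exprz_ge0 // ltW.
(* A point of the list yields a ray [rho'], hence [d < n] by the rank; this makes [n - d - 2] equal
   to [N - 1] despite the truncated subtraction in [N]. *)
case: s us hs => [_ _|X0 s us hs]; first by rewrite mulr_ge0 // addr_ge0.
have dn : (d < n)%N.
  have [hX hX'] := hs X0 (mem_head _ _).
  have [rho' _] := not_flat_dyadic v S c A B X0 hfan hgg hc hX hX'.
  by rewrite -(mxrank_degmx v S rho' hfan) rank_leq_col.
have B1 : 1 <= B.
  by apply: le_trans hB; apply: le_trans (expR_ge1Dx _); rewrite lerDl expR_ge0.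
set m := Num.truncn B.
have /andP[m1 m2] := truncn_itv (ltW B0); rewrite -/m in m1 m2.
have m0 : (0 < m)%N by rewrite truncn_gt0.
(* [L] is the integer part of the binary logarithm of [B]. *)
set L := trunc_log 2 m.
have /andP[L1 L2] := trunc_log_bounds (isT : (1 < 2)%N) m0; rewrite -/L in L1 L2.
have hL1 : 2 ^+ L <= B.
  by apply: le_trans m1; rewrite -natrX ler_nat.
have hL2 : B < 2 ^+ L.+1.
  by apply: lt_le_trans m2 _; rewrite -natrX ler_nat.
(* Chosen so that the flatness threshold is at most [2 ^+ w]. *)
set w := (Num.truncn (A * ll / p)).+1.
have Al0 : 0 <= A * ll / p by rewrite divr_ge0 ?mulr_ge0 // ltW.
have /andP[w1 w2] := truncn_itv Al0; rewrite -/w in w2.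
have hw : l `^ A <= 2 ^+ w.
  rewrite -ler_ln ?posrE ?powR_gt0 ?exprn_gt0 // ln_powR lnXn //.
  by rewrite -/ll -/p -mulr_natl -ler_pdivrMr // ltW.
have key : (size (X0 :: s))%:R <=
    K%:R * (w.+1%:R * L.+1%:R ^+ N * (2 ^+ L / L.+1%:R)) :> R.
  apply: hK => // X /[dup] hXs /hs [hX hX']; split; first by case: hX.
  have [rho' [t [h1 h2 h3]]] := not_flat_dyadic v S c A B X hfan hgg hc hX hX'.
  exists rho', t; split=> //.
    have := le_lt_trans h2 hL2; rewrite ltr_eXn2l ?ltr1n //.
  rewrite -(@ler_eXn2l R 2) ?ltr1n //; apply: le_trans h3 _.
  by rewrite exprD mulrC ler_wpM2r // exprn_ge0.
apply: le_trans key _.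
have eN : l ^ (n%:Z - d%:Z - 2) = l ^+ N / l.
  have -> : n%:Z - d%:Z - 2 = N%:Z - 1 by rewrite /N; move: dn; clear; lia.
  by rewrite expfzDr ?gt_eqF // exprN1.
have hw' : w.+1%:R <= (A / p + 2) * ll.
  rewrite /w -natr1 -natr1 mulrDl -addrA; apply: lerD; first by rewrite [leRHS]mulrAC.
  by rewrite -[1 + 1]/2 ler_peMr.
have hLn : L.+1%:R <= (p^-1 + 1) * l.
  have : L%:R * p <= l.
    by rewrite /p mulr_natl -lnXn // ler_ln ?posrE ?exprn_gt0.
  rewrite -ler_pdivlMr // -natr1 mulrDl mul1r [p^-1 * _]mulrC => h.
  exact: lerD.
have hLi : 2 ^+ L / L.+1%:R <= B * (p / l).
  apply: ler_pM; rewrite ?exprn_ge0 ?invr_ge0 //.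
  rewrite -[p / l]invf_div lef_pV2 ?posrE ?divr_gt0 // ler_pdivrMr //.
  by rewrite /p mulr_natl -lnXn // ler_ln ?posrE ?exprn_gt0 // ltW.
rewrite eN.
apply: (@le_trans _ _ (K%:R * ((A / p + 2) * ll * ((p^-1 + 1) * l) ^+ N * (B * (p / l))))).
  rewrite ler_wpM2l //; apply: ler_pM; rewrite ?mulr_ge0 ?exprn_ge0 ?invr_ge0 //.
  by apply: ler_pM; rewrite ?exprn_ge0 // lerXn2r // nnegrE // (le_trans _ hLn).
apply: (@le_trans _ _ (C * (B * (l ^+ N / l * ll)))); last first.
  by rewrite ler_wpM2r ?lerDl // -eN.
rewrite /C exprMn le_eqVlt; apply/predU1P; left; ring.
Qed.
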